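(* Assume the Continuum Hypothesis. Let $X$ be a weakly compactly generated (WCG) real Banach space with $\operatorname{dens} X = \omega_1$. Then $X$ contains a relatively weakly compact overcomplete set.
   Context: A Banach space is WCG if it contains a linearly dense, weakly compact subset. $\operatorname{dens}$ denotes the density character. A subset $S$ of a Banach space $X$ with $|S| = \operatorname{dens} X$ is called overcomplete if every subset $\Lambda \subseteq S$ with $|\Lambda| = |S|$ is linearly dense in $X$. *)

(* Defs.v *)
From HB Require Import structures.
From mathcomp Require Import all_boot all_order all_algebra.
From mathcomp Require Import all_classical all_reals all_analysis.
Set Implicit Arguments. Unset Strict Implicit. Unset Printing Implicit Defensive.
Import Order.TTheory GRing.Theory Num.Theory.
Import numFieldNormedType.Exports.
Local Open Scope classical_set_scope.
Local Open Scope ring_scope.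

Definition wellorder_on T (A : set T) (r : T -> T -> Prop) : Prop :=
  [/\ (forall x, A x -> ~ r x x),
      (forall x y z, A x -> A y -> A z -> r x y -> r y z -> r x z),
      (forall x y, A x -> A y -> [\/ r x y, x = y | r y x]) &
      (forall B, B `<=` A -> B !=set0 ->
         exists2 m, B m & forall b, B b -> ~ r b m)].

(* A has cardinality aleph_1: A is uncountable and carries a well-order
   all of whose proper initial segments are countable (order type omega_1). *)
Definition is_aleph1 T (A : set T) : Prop :=
  ~ countable A /\
  exists r, wellorder_on A r /\
    forall x, A x -> countable [set y | A y /\ r y x].

Definition CH : Prop := is_aleph1 [set: nat -> bool].

Section Banach.
Context {R : realType} {X : normedModType R}.

Definition dual_fun (f : X -> R) : Prop :=
  (forall (a : R) (x y : X), f (a *: x + y) = a * f x + f y) /\ continuous f.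

Definition weak_open (U : set X) : Prop :=
  forall x, U x -> exists (n : nat) (f : 'I_n -> X -> R) (e : R),
    [/\ (forall i, dual_fun (f i)), 0 < e &
        [set y | forall i, `|f i y - f i x| < e] `<=` U].

Definition weak_closure (S : set X) : set X :=
  [set x | forall U, weak_open U -> U x -> S `&` U !=set0].

Definition weakly_compact (K : set X) : Prop :=
  forall C : set (set X), (forall U, C U -> weak_open U) ->
    K `<=` \bigcup_(U in C) U ->
    exists s : seq (set X), (forall U, U \in s -> C U) /\
      K `<=` \bigcup_(U in [set U | U \in s]) U.

Definition relatively_weakly_compact (S : set X) : Prop :=
  weakly_compact (weak_closure S).

Definition lin_span (S : set X) : set X :=
  [set x | exists (n : nat) (c : 'I_n -> R) (v : 'I_n -> X),
     (forall i, S (v i)) /\ x = \sum_(i < n) c i *: v i].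

Definition linearly_dense (S : set X) : Prop := closure (lin_span S) = setT.

Definition dense_set (D : set X) : Prop := closure D = setT.

Definition WCG : Prop := exists K : set X, weakly_compact K /\ linearly_dense K.

Definition dens_aleph1 : Prop :=
  (exists D : set X, dense_set D /\ is_aleph1 D) /\
  (forall D : set X, dense_set D -> ~ countable D).

(* overcomplete set, given that dens X = aleph_1: |S| = aleph_1 and every
   subset of the same cardinality as S is linearly dense *)
Definition overcomplete (S : set X) : Prop :=
  is_aleph1 S /\
  forall L : set X, L `<=` S -> (L #= S)%card -> linearly_dense L.

End Banach.

(* Main.v *)
Require Import Defs.
From mathcomp Require Import all_boot all_order all_algebra.
From mathcomp Require Import all_classical all_reals all_analysis.
From mathcomp Require Import lra ring.

(** Under CH the space has [aleph_1] points and, because a weakly compact set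
  with at most continuum many points carries at most continuum many weakly
  continuous functions and functionals are determined by their values on a
  linearly dense set, also [aleph_1] functionals. Enumerate the nonzero
  functionals in type [omega_1] and choose, for each [a < omega_1], a point
  [p a] outside the kernels of the countably many functionals listed up to [a].
  An uncountable set of points [p a] is annihilated by no nonzero functional, so
  it is linearly dense by Hahn-Banach. With [K] weakly compact and linearly
  dense, the points are taken among the sums of series [sum_n c_n y_n] with
  [y_n] in [K], [0 <= c_n <= 1] and [|c_n y_n| <= 2^-n]; these sums form a weakly
  compact set, and it contains points off any given sequence of closed
  hyperplanes. *)

Set Implicit Arguments. Unset Strict Implicit. Unset Printing Implicit Defensive.
Import Order.TTheory GRing.Theory Num.Theory.
Import numFieldNormedType.Exports.
Local Open Scope classical_set_scope.
Local Open Scope ring_scope.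

(** * Hahn-Banach *)

Definition sublinear (R : realType) (V : lmodType R) (q : V -> R) : Prop :=
  (forall x y, q (x + y) <= q x + q y) /\
  (forall t x, 0 <= t -> q (t *: x) = t * q x).

Lemma sublinear_opp (R : realType) (V : lmodType R) (q : V -> R) x :
  sublinear q -> - q (- x) <= q x.
Proof.
case=> qD qZ; have := qD x (- x).
have := qZ 0 0 (lexx _); rewrite scale0r mul0r subrr => ->; lra.
Qed.

(** The bound [b] keeps the infimum finite. For homogeneity one inequality is enough, the other
    being its instance at [t^-1]. *)
Lemma sublinear_inf (R : realType) (V : lmodType R) (I : Type) (A : set I)
    (F : I -> V -> R) (b : V -> R) :
  A !=set0 -> (forall i x, A i -> b x <= F i x) ->
  (forall i j x y, A i -> A j -> exists2 k, A k & F k (x + y) <= F i x + F j y) ->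
  (forall i t x, A i -> 0 < t -> exists2 k, A k & F k (t *: x) <= t * F i x) ->
  sublinear (fun x => inf [set F i x | i in A]).
Proof.
move=> [i0 Ai0] bF FD FZ; set q := fun x => _.
have lbq i x : A i -> q x <= F i x.
  move=> Ai; apply: ge_inf; last by exists i.
  by exists (b x) => _ [j Aj <-]; apply: bF.
have qlb c x : (forall i, A i -> c <= F i x) -> c <= q x.
  by move=> cF; apply: lb_le_inf; [exists (F i0 x), i0|move=> _ [i Ai <-]; apply: cF].
have qZ t x : 0 < t -> q (t *: x) <= t * q x.
  move=> t0; rewrite mulrC -ler_pdivrMr //; apply: qlb => i Ai.
  rewrite ler_pdivrMr // mulrC; have [k Ak] := FZ i t x Ai t0.
  by apply: le_trans; apply: lbq.
have qZe t x : 0 < t -> q (t *: x) = t * q x.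
  move=> t0; apply/eqP; rewrite eq_le qZ //=.
  have := qZ t^-1 (t *: x); rewrite invr_gt0 => /(_ t0).
  by rewrite scalerA mulVf ?gt_eqF // scale1r mulrC ler_pdivlMr // mulrC.
split=> [x y|t x].
  rewrite -lerBlDr; apply: (qlb) => i Ai; rewrite lerBlDr -lerBlDl.
  apply: qlb => j Aj; rewrite lerBlDl; have [k Ak] := FD i j x y Ai Aj.
  by apply: le_trans; apply: lbq.
rewrite le_eqVlt => /orP[/eqP <-|]; last exact: qZe.
have := @qZe 2 0; rewrite ltr0n scaler0 scale0r mul0r => /(_ isT); lra.
Qed.

(* [q' x] is the infimum of [q (x + t y) - t q y] over [t >= 0]. If [q] is
   minimal then [q' = q], so the last inequality makes [q] additive. *)
Lemma sublinear_tilt (R : realType) (V : lmodType R) (q : V -> R) (y : V) :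
  sublinear q -> exists q', [/\ sublinear q', forall x, q' x <= q x &
    forall x, q' x <= q (x + y) - q y].
Proof.
move=> sq; have [qD qZ] := sq; pose F (t : R) x := q (x + t *: y) - t * q y.
pose A := [set t : R | 0 <= t].
have bF i x : A i -> - q (- x) <= F i x.
  move=> Ai; rewrite /F -qZ //; have := qD (- x) (x + i *: y).
  by rewrite addKr; lra.
have lb i x : A i -> inf [set F i x | i in A] <= F i x.
  move=> Ai; apply: ge_inf; last by exists i.
  by exists (- q (- x)) => _ [j Aj <-]; apply: bF.
exists (fun x => inf [set F i x | i in A]); split.
- apply: (@sublinear_inf _ _ _ _ _ (fun x => - q (- x))) => //.
  + by exists 0; rewrite /A /=.
  + move=> i j x x' Ai Aj; exists (i + j); first exact: addr_ge0.
    rewrite /F scalerDl addrACA; have := qD (x + i *: y) (x' + j *: y); lra.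
  + move=> i t x Ai t0; exists (t * i); first by rewrite /A /= mulr_ge0 // ltW.
    by rewrite /F -scalerA -scalerDr (qZ _ _ (ltW t0)); lra.
- move=> x; have := lb 0 x; rewrite /A /= lexx => /(_ isT).
  by rewrite /F scale0r mul0r addr0 subr0.
- move=> x; have := lb 1 x; rewrite /A /= ler01 => /(_ isT).
  by rewrite /F scale1r mul1r.
Qed.

(** Zorn's lemma gives a minimal sublinear minorant of [p], since chains have pointwise infima. By
    [sublinear_tilt] it is additive, hence linear. *)
Lemma sublinear_minorant (R : realType) (V : lmodType R) (p : V -> R) :
  sublinear p -> exists f : V -> R,
    (forall (a : R) x y, f (a *: x + y) = a * f x + f y) /\ forall x, f x <= p x.
Proof.
move=> sp; pose T := {q : V -> R | sublinear q /\ forall x, q x <= p x}.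
(* The order is reversed, so that a maximal element is pointwise minimal. *)
pose r (s t : T) := `[< forall x, sval t x <= sval s x >].
have [| | | |[q [sq qp]] qmin] := @Zorn T r.
- by move=> t; apply/asboolP.
- move=> s t u /asboolP st /asboolP tu; apply/asboolP => x.
  exact: le_trans (tu x) (st x).
- move=> [s ps] [t pt] /asboolP /= st /asboolP /= ts; apply: eq_exist.
  by apply/funext => x; apply/eqP; rewrite eq_le st ts.
- move=> A tA; have [[s0 As0]|A0] := pselect (A !=set0); last first.
    by exists (exist _ p (conj sp (fun x => lexx _))) => s As; case: A0; exists s.
  have lbA (s : T) x : A s -> - p (- x) <= sval s x.
    move=> _; case: s => s [ss sp'] /=; have := sublinear_opp x ss.
    have := sp' (- x); lra.
  have lb (s : T) x : A s -> inf [set sval s x | s in A] <= sval s x.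
    move=> As; apply: ge_inf; last by exists s.
    by exists (- p (- x)) => _ [j Aj <-]; apply: lbA.
  suff sI : sublinear (fun x => inf [set sval s x | s in A]).
    have Ip x : inf [set sval s x | s in A] <= p x.
      by apply: le_trans (lb s0 x As0) _; case: (s0) => s [].
    exists (exist _ _ (conj sI Ip) : T) => s As.
    by apply/asboolP => x /=; apply: lb.
  apply: (sublinear_inf _ lbA); first by exists s0.
    move=> i j x y Ai Aj; have [/asboolP ij|/asboolP ji] := tA _ _ Ai Aj.
      exists j => //; case: (j) ij => /= q [[qD _] _] ij.
      by apply: le_trans (qD _ _) _; rewrite lerD2r.
    exists i => //; case: (i) ji => /= q [[qD _] _] ji.
    by apply: le_trans (qD _ _) _; rewrite lerD2l.
  by move=> i t x Ai t0; exists i => //; case: (i) => q [[_ qZ] _] /=; rewrite qZ // ltW.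
have qadd x y : q (x + y) = q x + q y.
  have [q' [sq' q'q q'y]] := sublinear_tilt y sq.
  have pq' : sublinear q' /\ forall x, q' x <= p x.
    by split=> // z; apply: le_trans (q'q z) (qp z).
  have /(congr1 sval) /= e := qmin (exist _ q' pq') (introT (asboolP _) q'q).
  apply/eqP; rewrite eq_le; case: (sq) => -> _ /=.
  by have := q'y x; rewrite e; lra.
have q0 : q 0 = 0 by case: (sq) => _ /(_ 0 0 (lexx _)); rewrite scale0r mul0r.
have qN x : q (- x) = - q x by have := qadd x (- x); rewrite subrr q0; lra.
exists q; split=> // a x y; rewrite qadd; congr (_ + _).
case: (sq) => _ qZ; have [a0|a0] := leP 0 a; first exact: qZ.
by rewrite -[a]opprK scaleNr qN qZ ?oppr_ge0 ?(ltW a0) // mulNr !opprK.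
Qed.

(** Tilting [p] at [x0] first forces equality there: the tilted function is at most [- p x0] at
    [- x0], so each linear minorant of it is at least [p x0] at [x0]. *)
Lemma hahn_banach_sublinear (R : realType) (V : lmodType R) (p : V -> R) x0 :
  sublinear p -> exists f : V -> R,
    [/\ forall (a : R) x y, f (a *: x + y) = a * f x + f y,
        forall x, f x <= p x & f x0 = p x0].
Proof.
move=> sp; have [q [sq qp qx0]] := sublinear_tilt x0 sp.
have [f [fL fq]] := sublinear_minorant sq.
have p0 : p 0 = 0 by case: (sp) => _ /(_ 0 0 (lexx _)); rewrite scale0r mul0r.
exists f; split=> // [x|]; first exact: le_trans (fq x) (qp x).
apply/eqP; rewrite eq_le (le_trans (fq x0) (qp x0)) /=.
have := qx0 (- x0); rewrite addNr p0; have := fq (- x0).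
have := fL (-1) x0 0; have := fL 1 0 0.
rewrite scaler0 !addr0 scaleN1r; lra.
Qed.

(** * Continuous functionals and separation from closed spans *)

Section DualFun.
Context {R : realType} {X : normedModType R}.
Implicit Types (f : X -> R) (x y : X).

Lemma dual_fun0 f : dual_fun f -> f 0 = 0.
Proof. by case=> fL _; have := fL 1 0 0; rewrite scaler0 addr0; lra. Qed.

Lemma dual_funD f x y : dual_fun f -> f (x + y) = f x + f y.
Proof. by case=> fL _; rewrite -{1}[x]scale1r fL mul1r. Qed.

Lemma dual_funZ f a x : dual_fun f -> f (a *: x) = a * f x.
Proof. by move=> df; rewrite -[a *: x]addr0 (df.1) dual_fun0 // addr0. Qed.

Lemma dual_funN f x : dual_fun f -> f (- x) = - f x.
Proof. by move=> df; rewrite -scaleN1r dual_funZ // mulN1r. Qed.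

Lemma dual_funB f x y : dual_fun f -> f (x - y) = f x - f y.
Proof. by move=> df; rewrite dual_funD // dual_funN. Qed.

Lemma dual_fun_sum f (I : Type) (s : seq I) (P : pred I) (v : I -> X) :
  dual_fun f -> f (\sum_(i <- s | P i) v i) = \sum_(i <- s | P i) f (v i).
Proof.
move=> df; apply: (big_morph f) => [x y|]; first exact: dual_funD.
exact: dual_fun0.
Qed.

Lemma dual_fun_bounded f : dual_fun f ->
  exists2 M, 0 < M & forall x, `|f x| <= M * `|x|.
Proof.
move=> df; have := df.2 0; rewrite /continuous_at dual_fun0 //.
move=> /cvgrPdist_lt/(_ 1 ltr01)/nbhs_ballP[d /= d0 dP].
exists (2 / d); first by rewrite divr_gt0.
move=> x; have [->|x0] := eqVneq x 0; first by rewrite dual_fun0 // !normr0 mulr0.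
have nx : 0 < `|x| by rewrite normr_gt0.
(* Rescaled to norm [d / 2], the vector falls where [f] is below 1 in absolute value; hence the
   constant [2 / d]. *)
have : ball 0 d ((d / (2 * `|x|)) *: x).
  rewrite -ball_normE /= sub0r normrN normrZ ger0_norm; last first.
    by rewrite divr_ge0 ?mulr_ge0 ?(ltW d0).
  rewrite invfM -!mulrA mulVf ?gt_eqF // mulr1; lra.
move=> /dP /=; rewrite sub0r normrN dual_funZ // normrM ger0_norm; last first.
  by rewrite divr_ge0 ?mulr_ge0 ?(ltW d0).
rewrite mulrAC ltr_pdivrMr ?mul1r ?mulr_gt0 // => H.
by rewrite mulrAC ler_pdivlMr // mulrC ltW.
Qed.

Lemma bounded_dual_fun f M :
  (forall (a : R) x y, f (a *: x + y) = a * f x + f y) ->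
  (forall x, f x <= M * `|x|) -> dual_fun f.
Proof.
move=> fL fM; split=> // x; apply/cvgrPdist_lt => e e0.
have fB u v : f u - f v = f (u - v).
  by have := fL (-1) v u; rewrite scaleN1r addrC => ->; lra.
have fle u : `|f u| <= `|M| * `|u|.
  have {}fM v : f v <= `|M| * `|v|.
    by apply: le_trans (fM v) _; rewrite ler_wpM2r // ler_norm.
  rewrite ler_norml fM andbT; have := fM (- u).
  have f0 : f 0 = 0 by have := fL 1 0 0; rewrite scaler0 addr0; lra.
  by have := fB 0 u; rewrite f0 !sub0r normrN => <-; lra.
have M1 : 0 < `|M| + 1 by rewrite ltr_wpDl.
apply/nbhs_ballP; exists (e / (`|M| + 1)); first by rewrite /= divr_gt0.
move=> y; rewrite -ball_normE /= ltr_pdivlMr // => xy.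
rewrite fB; apply: le_lt_trans (fle _) _; apply: le_lt_trans xy.
by rewrite mulrC ler_wpM2l // lerDl.
Qed.

Lemma norming_functional x0 :
  exists f, [/\ dual_fun f, forall x, `|f x| <= `|x| & f x0 = `|x0|].
Proof.
have sN : sublinear (fun x : X => `|x|).
  by split=> [|t x t0]; [exact: ler_normD|rewrite normrZ ger0_norm].
have [f [fL fN fx0]] := hahn_banach_sublinear x0 sN.
have df : dual_fun f.
  by apply: (@bounded_dual_fun _ 1) => // x; rewrite mul1r.
exists f; split=> // x; rewrite ler_norml fN andbT.
by have := fN (- x); rewrite normrN dual_funN //; lra.
Qed.

Lemma dual_fun_separates x y : (forall f, dual_fun f -> f x = f y) -> x = y.
Proof.
move=> xy; have [f [df _ fxy]] := norming_functional (x - y).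
apply/eqP; rewrite -subr_eq0 -normr_eq0 -fxy dual_funB //.
by rewrite xy // subrr.
Qed.

Lemma lin_spanD (A : set X) x y :
  lin_span A x -> lin_span A y -> lin_span A (x + y).
Proof.
move=> [n [c [v [Av ->]]]] [m [d [w [Aw ->]]]].
exists (n + m)%N, (fun i : 'I_(n + m) => match fintype.split i with inl j => c j | inr j => d j end),
  (fun i : 'I_(n + m) => match fintype.split i with inl j => v j | inr j => w j end); split.
  by move=> i; case: (fintype.split i).
rewrite big_split_ord /=; congr (_ + _); apply: eq_bigr => i _.
  by have := unsplitK (inl i : 'I_n + 'I_m); rewrite /= => ->.
by have := unsplitK (inr i : 'I_n + 'I_m); rewrite /= => ->.
Qed.

Lemma lin_spanZ (A : set X) a x : lin_span A x -> lin_span A (a *: x).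
Proof.
move=> [n [c [v [Av ->]]]]; exists n, (fun i => a * c i), v; split=> //.
by rewrite scaler_sumr; apply: eq_bigr => i _; rewrite scalerA.
Qed.

Lemma sub_lin_span (A : set X) : A `<=` lin_span A.
Proof.
move=> x Ax; exists 1%N, (fun=> 1), (fun=> x); split=> //.
by rewrite big_ord1 scale1r.
Qed.

Lemma lin_span0 (A : set X) : lin_span A 0.
Proof.
exists 0%N, (fun=> 0), (fun=> 0); split; first by case.
by rewrite big_ord0.
Qed.

(** Hahn-Banach is applied to [p], the distance to the span. As [f <= p <= 0] on the symmetric span,
    [f] vanishes there, while [f x0] is the positive distance of [x0]. *)
Lemma separating_functional (A : set X) x0 : ~ closure (lin_span A) x0 ->
  exists f, [/\ dual_fun f, forall x, A x -> f x = 0 & f x0 != 0].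
Proof.
move=> nx0; pose F (m x : X) := `|x - m|.
have F0 m x : lin_span A m -> 0 <= F m x by move=> _; exact: normr_ge0.
pose p x := inf [set F m x | m in lin_span A].
have ple m x : lin_span A m -> p x <= `|x - m|.
  move=> Am; apply: ge_inf; last by exists m.
  by exists 0 => _ [j Aj <-]; exact: F0.
have sp : sublinear p.
  apply: (sublinear_inf _ F0); first by exists 0; exact: lin_span0.
    move=> i j x y Ai Aj; exists (i + j); first exact: lin_spanD.
    by rewrite /F opprD addrACA ler_normD.
  move=> i t x Ai t0; exists (t *: i); first exact: lin_spanZ.
  by rewrite /F -scalerBr normrZ gtr0_norm.
have [f [fL fp fx0]] := hahn_banach_sublinear x0 sp.
have df : dual_fun f.
  apply: (@bounded_dual_fun _ 1) => // x; rewrite mul1r.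
  by apply: le_trans (fp x) _; have := ple 0 x (lin_span0 A); rewrite subr0.
have f0 x : lin_span A x -> f x <= 0.
  by move=> Ax; apply: le_trans (fp x) _; have := ple x x Ax; rewrite subrr normr0.
exists f; split=> // [x /sub_lin_span Ax|].
  apply/eqP; rewrite eq_le f0 //=; have := f0 _ (lin_spanZ (-1) Ax).
  by rewrite dual_funZ //; lra.
have [B nB AB] : exists2 B, nbhs x0 B & forall x, lin_span A x -> ~ B x.
  move: nx0; rewrite /closure /= => /existsNP[B /not_implyP[nB AB]].
  by exists B => // x Ax Bx; apply: AB; exists x.
have /nbhs_ballP[e /= e0 eB] := nB.
rewrite fx0 gt_eqF //; apply: lt_le_trans e0 _.
apply: lb_le_inf; first by exists (F 0 x0), 0 => //; exact: lin_span0.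
move=> _ [m Am <-]; rewrite leNgt; apply/negP => lt.
by apply: (AB m Am); apply: eB; rewrite -ball_normE.
Qed.

(** This dual criterion serves both to find points of [K] outside a kernel and to prove that large
    sets of points are linearly dense. *)
Lemma linearly_denseP (A : set X) : linearly_dense A <->
  forall f, dual_fun f -> (forall x, A x -> f x = 0) -> forall x, f x = 0.
Proof.
split=> [dA f df fA x|H].
  have fspan y : lin_span A y -> f y = 0.
    move=> [n [c [v [Av ->]]]]; rewrite dual_fun_sum // big1 // => i _.
    by rewrite dual_funZ // fA // mulr0.
  have [M M0 fM] := dual_fun_bounded df.
  apply/eqP; apply: contraT => fx.
  have nfx : 0 < `|f x| by rewrite normr_gt0.
  have : closure (lin_span A) x by rewrite dA.
  move=> /(_ (ball x (`|f x| / M))) [|y [Ay]].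
    by apply: nbhsx_ballx; rewrite divr_gt0.
  rewrite -ball_normE /= ltr_pdivlMr // => xy.
  have := fM (x - y); rewrite dual_funB // (fspan y) // subr0 mulrC => xy'.
  by have := lt_le_trans xy xy'; rewrite ltxx.
rewrite /linearly_dense -subTset => x _; apply: contrapT => nx.
have [f [df fA /eqP]] := separating_functional nx.
by apply; exact: H.
Qed.

End DualFun.

(** * Weak compactness by ultrafilters *)

Lemma fmap_ultra (T U : Type) (g : T -> U) (F : set_system T) :
  UltraFilter F -> UltraFilter (g @ F).
Proof.
move=> FU; split=> [|G GP FG]; first exact: fmap_proper_filter.
apply/seteqP; split; last exact: FG.
move=> A GA; have [//|FnA] := in_ultra_setVsetC (g @^-1` A) FU.
have GnA : G (~` A) by apply: FG.
by have /filter_ex [? []] : G (A `&` ~` A) by exact: filterI.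
Qed.

Section Weak.
Context {R : realType} {X : normedModType R}.
Implicit Types (f : X -> R) (x y : X).

(** The map [g] is kept apart from the filter so that families over any index type can be followed
    along an ultrafilter. *)
Definition weak_cvg (T : Type) (g : T -> X) (F : set_system T) (x : X) : Prop :=
  forall f, dual_fun f -> f (g t) @[t --> F] --> f x.

Lemma weak_cvg_unique (T : Type) (g : T -> X) (F : set_system T) x y :
  ProperFilter F -> weak_cvg g F x -> weak_cvg g F y -> x = y.
Proof.
move=> FF Fx Fy; apply: dual_fun_separates => f df.
exact: (cvg_unique (@norm_hausdorff _ _) (Fx f df) (Fy f df)).
Qed.

Lemma weak_openI (U V : set X) :
  weak_open U -> weak_open V -> weak_open (U `&` V).
Proof.
move=> oU oV x [/oU [n [f [e [df e0 fU]]]] /oV [m [g [d [dg d0 gV]]]]].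
exists (n + m)%N, (fun i : 'I_(n + m) => match fintype.split i with
  inl j => f j | inr j => g j end), (Num.min e d); split.
- by move=> i; case: (fintype.split i).
- by rewrite lt_min e0.
- move=> y /= H; split; [apply: fU => i /=|apply: gV => i /=].
    have := H (unsplit (inl i)); rewrite unsplitK lt_min.
    by move=> /andP[].
  have := H (unsplit (inr i)); rewrite unsplitK lt_min.
  by move=> /andP[].
Qed.

Lemma weak_openT : weak_open ([set: X]).
Proof.
move=> x _; exists 0%N, (fun _ _ => 0), 1; split=> //; first by case.
Qed.

Lemma weak_open_slab f x (e : R) : dual_fun f ->
  weak_open [set y | `|f y - f x| < e].
Proof.
move=> df z /= zx; exists 1%N, (fun=> f), (e - `|f z - f x|); split=> //.
  by rewrite subr_gt0.
move=> y /= /(_ ord0); rewrite ltrBrDr; apply: le_lt_trans.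
by apply: le_trans (ler_normD _ _); rewrite addrA subrK.
Qed.

Lemma weak_open_near (T : Type) (g : T -> X) (F : set_system T) x U :
  Filter F -> weak_cvg g F x -> weak_open U -> U x -> F (g @^-1` U).
Proof.
move=> FF Fx oU /oU [n [f [e [df e0 fU]]]].
have : \forall t \near F, forall i, `|f i (g t) - f i x| < e.
  apply: filter_forall => i; have /cvgrPdist_lt/(_ e e0) := Fx _ (df i).
  by apply: filterS => t; rewrite distrC.
by apply: filterS => t; exact: fU.
Qed.

(** If no point of [K] were a limit, each would lie in a slab whose preimage is not in [F]. Finitely
    many sets with this property cover [K], and the ultrafilter contains the complements of their
    preimages. *)
Lemma weakly_compact_ultra (T : Type) (g : T -> X) (F : set_system T) K :
  UltraFilter F -> weakly_compact K -> F (g @^-1` K) ->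
  exists2 x, K x & weak_cvg g F x.
Proof.
move=> FU cK FK; apply: contrapT => noK.
pose C := [set U : set X | weak_open U /\ ~ F (g @^-1` U)].
have [|x Kx|s [sC Ks]] := cK C; first by move=> U [].
  apply: contrapT => nC; apply: noK; exists x => // f df.
  apply/cvgrPdist_lt => e e0; apply: contrapT => nF; apply: nC.
  exists [set y | `|f y - f x| < e]; last by rewrite /= subrr normr0.
  split; first exact: weak_open_slab.
  by move=> H; apply: nF; apply: filterS H => t /=; rewrite distrC.
have : F [set t | forall U, U \in s -> ~ U (g t)].
  elim: s sC {Ks} => [|V s IHs] sC; first by apply: filterS filterT => t _ U.
  have {}IHs := IHs (fun U Us => sC U (mem_behead (s := V :: s) Us)).
  have [_ nV] := sC V (mem_head _ _).
  have [//|FnV] := in_ultra_setVsetC (g @^-1` V) FU.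
  apply: filterS (filterI FnV IHs) => t [nVt st] U.
  by rewrite inE => /orP[/eqP ->//|]; exact: st.
move=> /(filterI FK)/filter_ex [t [Kt st]].
by have [U /= Us Ut] := Ks _ Kt; apply: (st U).
Qed.

(** Without a finite subcover, the sets [K] minus a finite union from [C] generate a proper filter.
    An ultrafilter above it converges to a point of some [U] in [C], so it contains both [U] and [K]
    minus [U]. *)
Lemma ultra_weakly_compact (K : set X) :
  (forall F : set_system X, UltraFilter F -> F K ->
    exists2 x, K x & weak_cvg id F x) -> weakly_compact K.
Proof.
move=> HK C oC KC; apply: contrapT => noS.
pose G := [set A : set X | exists s : seq (set X), (forall U, U \in s -> C U) /\
  K `\` \bigcup_(U in [set U | U \in s]) U `<=` A].
have GF : ProperFilter G.
  apply: Build_ProperFilter_ex => [A [s [sC sA]]|].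
    apply: contrapT => nA; apply: noS; exists s; split=> // x Kx.
    by apply: contrapT => nx; apply: nA; exists x; apply: sA.
  split.
  - by exists [::]; split.
  - move=> A B [s [sC sA]] [t [tC tB]]; exists (s ++ t); split.
      by move=> U; rewrite mem_cat => /orP[/sC|/tC].
    move=> x [Kx nx]; split; [apply: sA|apply: tB]; split=> // -[U /= Us Ux];
      by apply: nx; exists U => //=; rewrite mem_cat Us ?orbT.
  - by move=> A B AB [s [sC sA]]; exists s; split=> //; exact: subset_trans AB.
have [F [FU GsF]] := ultraFilterLemma GF.
have FK : F K by apply: GsF; exists [::]; split=> // x [].
have [x Kx Fx] := HK F FU FK; have [U CU Ux] := KC x Kx.
have FUU : F U by exact: (weak_open_near _ Fx (oC U CU) Ux).
have : F (K `\` U).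
  apply: GsF; exists [:: U]; split=> [V|y [Ky nU]]; first by rewrite inE => /eqP ->.
  by split=> // Uy; apply: nU; exists U => //=; rewrite inE.
by move=> /(filterI FUU)/filter_ex [y [? []]].
Qed.

(** Uniqueness of weak limits puts the weak closure inside [L]. An ultrafilter on the closure then
    has a limit in [L], and every weakly open set around that limit meets the closure, hence [S]. *)
Lemma relatively_weakly_compact_sub (L S : set X) :
  weakly_compact L -> S `<=` L -> relatively_weakly_compact S.
Proof.
move=> cL SL.
have clL : weak_closure S `<=` L.
  move=> x Sx; pose G := [set A : set X | exists U, [/\ weak_open U, U x &
    S `&` U `<=` A]].
  have GF : ProperFilter G.
    apply: Build_ProperFilter_ex => [A [U [oU Ux UA]]|].
      by have [y SUy] := Sx U oU Ux; exists y; exact: UA.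
    split.
    - by exists setT; split=> //; exact: weak_openT.
    - move=> A B [U [oU Ux UA]] [V [oV Vx VB]]; exists (U `&` V).
      split=> //; first exact: weak_openI.
      by move=> y [Sy [Uy Vy]]; split; [exact: UA|exact: VB].
    - by move=> A B AB [U [oU Ux UA]]; exists U; split=> //; exact: subset_trans AB.
  have [F [FU GsF]] := ultraFilterLemma GF.
  have FL : F L.
    apply: GsF; exists setT; split=> //; first exact: weak_openT.
    by move=> y [/SL].
  have [y Ly Fy] := @weakly_compact_ultra X id F L FU cL FL.
  suff -> : x = y by [].
  apply: (@weak_cvg_unique X id F) Fy => f df.
  apply/cvgrPdist_lt => e e0; apply: GsF.
  exists [set y | `|f y - f x| < e]; split.
  - exact: weak_open_slab.
  - by rewrite /= subrr normr0.
  - by move=> z [_ /=]; rewrite distrC.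
apply: ultra_weakly_compact => F FU FS.
have FL : F L by apply: filterS FS.
have [y Ly Fy] := @weakly_compact_ultra X id F L FU cL FL.
exists y => // U oU Uy.
have FUU : F U by exact: (weak_open_near _ Fy oU Uy).
have [z [Uz Sz]] := filter_ex (filterI FUU FS).
exact: Sz U oU Uz.
Qed.

(** Along an ultrafilter the coefficients converge by compactness of the segment and the vectors by
    weak compactness of [K], so the products converge weakly. *)
Lemma weakly_compact_scaled_ball (K : set X) (r : R) : weakly_compact K ->
  weakly_compact [set w | `|w| <= r /\
    exists2 c, 0 <= c <= 1 & exists2 y, K y & w = c *: y].
Proof.
move=> cK; apply: ultra_weakly_compact => F FU FP; set P := (X in F X) in FP *.
have /choice [cy cyP] : forall w, exists cy : R * X, P w ->
    [/\ 0 <= cy.1 <= 1, K cy.2 & w = cy.1 *: cy.2].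
  move=> w; have [[wr [c c01 [y Ky wE]]]|nP] := pselect (P w).
    by exists (c, y).
  by exists (0, 0).
have [y Ky Fy] : exists2 y, K y & weak_cvg (fun w => (cy w).2) F y.
  apply: weakly_compact_ultra cK _.
  by apply: filterS FP => w Pw; have [] := cyP w Pw.
have [c [c01 Fc]] : exists c : R, 0 <= c <= 1 /\ (cy w).1 @[w --> F] --> c.
  have := @segment_compact R 0 1; rewrite compact_ultra => cI.
  have UI := fmap_ultra (fun w => (cy w).1) FU.
  have [|c [c01 Fc]] := cI _ UI; last by exists c; split=> //; rewrite /= in_itv in c01.
  by apply: (@filterS _ F _ _ _ _ FP) => w Pw; have [] := cyP w Pw; rewrite /= in_itv.
have Fw : weak_cvg id F (c *: y).
  move=> f df; rewrite dual_funZ //.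
  have : (cy w).1 * f (cy w).2 @[w --> F] --> c * f y by apply: cvgM => //; exact: Fy.
  apply: cvg_trans; apply: near_eq_cvg; apply: filterS FP => w Pw.
  by have [_ _ wE] := cyP w Pw; rewrite -dual_funZ // -wE.
exists (c *: y) => //; split; last by exists c => //; exists y.
(* Norm bounds pass to weak limits: a functional norming the limit is at most the norm at every
   other point. *)
have [f [df fN <-]] := norming_functional (c *: y).
apply: (closed_cvg (fun x : R => x <= r) (@closed_le R r) _ _ (Fw f df)).
by apply: filterS FP => w [wr _]; apply: le_trans wr; apply: le_trans (fN w); exact: ler_norm.
Qed.

End Weak.

(** * Series with geometrically bounded terms *)

Lemma series_tail (R : realType) (X : normedModType R) (w : nat -> X) x N :
  (forall n, `|w n| <= 2^-1 ^+ n) -> series w @ \oo --> x ->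
  `|x - series w N| <= 2 * 2^-1 ^+ N.
Proof.
move=> wle wx.
(* Subtracting the remaining geometric mass makes the bound inductive: the term of index [N + k]
   uses up [2^-1 ^+ (N + k)] of it. *)
have H k : `|series w (N + k)%N - series w N| <=
    2 * 2^-1 ^+ N - 2 * 2^-1 ^+ (N + k).
  elim: k => [|k IH]; first by rewrite addn0 !subrr normr0.
  rewrite addnS -[series w _.+1]/(\sum_(0 <= i < (N + k).+1) w i) big_nat_recr //=.
  rewrite -/(series w (N + k)) addrAC; apply: le_trans (ler_normD _ _) _.
  apply: le_trans (lerD IH (wle _)) _; rewrite exprS; lra.
have c : `|series w (n + N)%N - series w N| @[n --> \oo] --> `|x - series w N|.
  apply: cvg_norm; apply: cvgB; last exact: cvg_cst.
  by have := wx; rewrite -(cvg_shiftn N).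
apply: (closed_cvg (fun x : R => x <= _) (@closed_le R _) _ _ c).
apply: nearW => k; rewrite addnC; apply: le_trans (H k) _.
by rewrite lerBlDr lerDl mulr_ge0 // exprn_ge0.
Qed.

Lemma geometric_bound_cvg (R : realType) (X : completeNormedModType R)
  (w : nat -> X) : (forall n, `|w n| <= 2^-1 ^+ n) -> cvgn (series w).
Proof.
move=> wle; apply: normed_cvg.
apply: (@series_le_cvg _ _ (geometric 1 2^-1)) => [n|n|n|].
- exact: normr_ge0.
- by rewrite /= mul1r exprn_ge0.
- by rewrite /= mul1r.
- by apply: is_cvg_geometric_series; rewrite ger0_norm //; lra.
Qed.

(** Each point is represented by one series; along the ultrafilter the [n]th terms have a weak limit
    in [P n], and these limits sum to some [x]. Uniformly small tails allow the exchange of limit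
    and sum. *)
Lemma weakly_compact_series (R : realType) (X : completeNormedModType R)
    (P : nat -> set X) :
  (forall n, weakly_compact (P n)) ->
  (forall n w, P n w -> `|w| <= 2^-1 ^+ n) ->
  weakly_compact [set x | exists w : nat -> X,
    (forall n, P n (w n)) /\ series w @ \oo --> x].
Proof.
move=> cP Ple; apply: ultra_weakly_compact => F FU FL; set L := (X in F X) in FL *.
have /choice [s sP] : forall x, exists w : nat -> X,
    L x -> (forall n, P n (w n)) /\ series w @ \oo --> x.
  move=> x; have [[w wP]|nL] := pselect (L x); first by exists w.
  by exists (fun=> 0).
have /choice [w wP] : forall n, exists w, P n w /\ weak_cvg (fun x => s x n) F w.
  move=> n; have [|w Pw Fw] := weakly_compact_ultra (g := fun x => s x n) FU (cP n).
    by apply: filterS FL => x Lx; have [sPx _] := sP x Lx; exact: sPx.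
  by exists w.
have wle n : `|w n| <= 2^-1 ^+ n by apply: Ple; have [] := wP n.
have wx := geometric_bound_cvg wle; set x := limn (series w) in wx.
exists x; first by exists w; split=> // n; have [] := wP n.
move=> f df; have [M M0 fM] := dual_fun_bounded df.
apply/cvgrPdist_lt => e e0.
have [N Ne] : exists N, M * (2 * 2^-1 ^+ N) < e / 3.
  have : geometric (M * 2) 2^-1 @ \oo --> (0 : R).
    by apply: cvg_geometric; rewrite ger0_norm //; lra.
  have e3 : 0 < e / 3 by lra.
  move=> /cvgrPdist_lt/(_ _ e3) [N _ /(_ N (leqnn _))].
  rewrite /= sub0r normrN => H; exists N; rewrite mulrA.
  by apply: le_lt_trans H; exact: ler_norm.
have sumN : f (series (s y) N) @[y --> F] --> f (series w N).
  rewrite /series /=; elim: N {Ne} => [|N IH].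
    by under eq_fun do rewrite big_geq //; rewrite big_geq //; exact: cvg_cst.
  under eq_fun do rewrite big_nat_recr //= dual_funD //.
  rewrite big_nat_recr //= dual_funD //; apply: cvgD => //.
  by have [_] := wP N; apply.
have e3 : 0 < e / 3 by lra.
have /cvgrPdist_lt/(_ _ e3) := sumN => H.
apply: filterS (filterI H FL) => y [Hy Ly]; have [sPy sy] := sP y Ly.
have t1 := fM (x - series w N).
have t2 := fM (y - series (s y) N).
have := @series_tail _ _ w x N wle wx.
have := @series_tail _ _ (s y) y N (fun n => Ple _ _ (sPy n)) sy.
move=> /(ler_wpM2l (ltW M0)) u2 /(ler_wpM2l (ltW M0)) u1.
have {t1 u1} := le_lt_trans (le_trans t1 u1) Ne.
have {t2 u2} := le_lt_trans (le_trans t2 u2) Ne.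
rewrite !(dual_funB _ _ df) => a b.
have -> : f x - f y = (f x - f (series w N)) + (f (series w N) - f (series (s y) N))
   - (f y - f (series (s y) N)) by ring.
apply: le_lt_trans (ler_normB _ _) _.
have := ler_normD (f x - f (series w N)) (f (series w N) - f (series (s y) N)).
lra.
Qed.

(** * Counting points and functionals *)

Definition le_continuum (T : Type) : Prop :=
  exists c : T -> nat -> bool, injective c.

Lemma le_continuum_inj (T U : Type) (g : T -> U) :
  injective g -> le_continuum U -> le_continuum T.
Proof. by move=> gi [c ci]; exists (c \o g); exact: inj_comp. Qed.

Lemma le_continuum_fun (I : countType) (T : Type) :
  le_continuum T -> le_continuum (I -> T).
Proof.
move=> [c ci]; exists (fun (g : I -> T) n =>
  if @unpickle (I * nat)%type n is Some p then c (g p.1) p.2 else false).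
move=> g h /funeqP gh; apply/funext => i; apply: ci; apply/funext => j.
by have := gh (pickle (i, j)); rewrite pickleK.
Qed.

Lemma le_continuum_prod (T U : Type) :
  le_continuum T -> le_continuum U -> le_continuum (T * U).
Proof.
move=> [c ci] [d di].
apply: (@le_continuum_inj _ (bool -> nat -> bool)
  (fun p b => if b then c p.1 else d p.2)); last first.
  by apply: le_continuum_fun; exists id.
move=> [x y] [x' y'] /funeqP H; congr (_, _); first exact: ci (H true).
exact: di (H false).
Qed.

Lemma rat_between (R : realType) (x y : R) :
  x < y -> exists q : rat, x < ratr q < y.
Proof.
move=> xy; have := @dense_rat R `]x, y[%classic.
case=> [||z [zxy [q _ qz]]].
- by exists ((x + y) / 2); rewrite /= in_itv /=; apply/andP; split; lra.
- exact: interval_open.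
- by exists q; rewrite qz; move: zxy; rewrite /= in_itv.
Qed.

(** A real is coded by its Dedekind cut in the rationals. *)
Lemma le_continuum_real (R : realType) : le_continuum R.
Proof.
apply: (@le_continuum_inj _ (rat -> bool) (fun (x : R) q => ratr q < x)); last first.
  apply: le_continuum_fun; exists (fun b _ => b) => b b' /funeqP H; exact: H 0%N.
have lt_neq (x y : R) : x < y ->
    (fun q : rat => ratr q < x) <> (fun q => ratr q < y).
  move=> /rat_between [q /andP[xq qy]] /funeqP/(_ q).
  by rewrite qy ltNge (ltW xq).
by move=> x y; case: (ltgtP x y) => // [/lt_neq|/lt_neq + /esym].
Qed.

Lemma aleph1_le_continuum (T : Type) (A : set T) :
  ~ countable [set: nat -> bool] -> is_aleph1 A ->
  exists c : T -> nat -> bool, forall x y, A x -> A y -> c x = c y -> x = y.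
Proof.
move=> unc [_ [r [[rirr rtr rtot rmin] seg]]].
pose lt x y := [/\ A x, A y & r x y].
have wf : well_founded lt.
  move=> x; apply: contrapT => nx; have Ax : A x.
    by apply: contrapT => nA; apply: nx; constructor => y [].
  have [||m [Am nm] mmin] := rmin [set z | A z /\ ~ Acc lt z].
  - by move=> z [].
  - by exists x.
  - apply: nm; constructor => y [Ay _ yx]; apply: contrapT => ny.
    exact: mmin y (conj Ay ny) yx.
pose step x (rec : forall y, lt y x -> nat -> bool) : nat -> bool :=
  get [set b | forall y (h : lt y x), rec y h <> b].
pose c := Fix wf (fun _ => nat -> bool) step.
have cE x : c x = get [set b | forall y, lt y x -> c y <> b].
  rewrite /c Fix_eq //= => z u v uv; rewrite /step; congr (xget _ _).
  apply/seteqP; split=> b H y h; first by rewrite -uv; exact: H.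
  by rewrite uv; exact: H.
have cP x y : lt y x -> c y <> c x.
  move=> yx; rewrite (cE x).
  have : exists b, forall y, lt y x -> c y <> b.
    apply: contrapT => nb; apply: unc.
    have Ax : A x by case: yx.
    have : countable [set c y | y in [set y | A y /\ r y x]].
      by apply: sub_countable (seg x Ax); exact: card_image_le.
    apply: sub_countable; apply: subset_card_le => b _.
    apply: contrapT => Nb; apply: nb; exists b => z [Az _ zx] cz.
    by apply: Nb; exists z.
  by move=> /getPex; apply.
exists c => x y Ax Ay cxy; case: (rtot x y Ax Ay) => // rxy.
  by case: (cP y x).
by case: (cP x y).
Qed.

(** A point is determined by a sequence of approximants from the dense set, one for each accuracy
    [n.+1%:R^-1]. *)
Lemma cardinal_dense (R : realType) (X : normedModType R) :
  ~ countable [set: nat -> bool] -> @dens_aleph1 R X -> le_continuum X.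
Proof.
move=> unc [[D [dD aD]] _]; have [c ci] := aleph1_le_continuum unc aD.
have /choice [d dP] : forall p : X * nat, exists y, D y /\ `|p.1 - y| < p.2.+1%:R^-1.
  move=> [x n]; have : closure D x by rewrite dD.
  move=> /(_ (ball x n.+1%:R^-1)) [|y [Dy]].
    by apply: nbhsx_ballx; rewrite invr_gt0 ltr0n.
  by rewrite -ball_normE; exists y.
apply: (@le_continuum_inj _ (nat -> nat -> bool) (fun x n => c (d (x, n)))).
  move=> x y /funeqP H; apply/eqP; rewrite -subr_eq0 -normr_eq0.
  rewrite eq_le normr_ge0 andbT leNgt; apply/negP => xy.
  have [n] : exists n : nat, n.+1%:R^-1 < `|x - y| / 2.
    have := @ltr_add_invr R 0 (`|x - y| / 2).
    by rewrite divr_gt0 // => /(_ isT) [n]; rewrite add0r; exists n.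
  have [Dx dx] := dP (x, n); have [Dy dy] := dP (y, n).
  have e := ci _ _ Dx Dy (H n); rewrite /= e in dx dy *.
  have := ler_distD (d (y, n)) x y; rewrite [`|d _ - _|]distrC.
  move: dx dy; move: n.+1%:R^-1 => a; lra.
by apply: le_continuum_fun; exists id.
Qed.

(** * Coding functionals by binary sequences *)

Section Coding.
Context {R : realType} {X : normedModType R}.
Implicit Types (f : X -> R) (x y z : X) (K : set X).

Lemma dual_fun_sub f g : dual_fun f -> dual_fun g ->
  dual_fun (fun x => f x - g x).
Proof.
move=> df dg; split=> [a x y|x]; first by rewrite df.1 dg.1; ring.
by apply: cvgB; [exact: df.2|exact: dg.2].
Qed.

(* Otherwise there are bad pairs for every finite [s]; along an ultrafilter of
   finite sets they converge weakly to a pair that all [d z] identify, hence to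
   a diagonal one. *)
Lemma dual_fun_finite_dependence K (d : X -> X -> R) f (e : R) :
  weakly_compact K -> (forall z, dual_fun (d z)) ->
  (forall z, d z z = 0 -> z = 0) -> dual_fun f -> 0 < e ->
  exists s : seq X, forall x y, K x -> K y ->
    (forall z, z \in s -> d z x = d z y) -> `|f x - f y| < e.
Proof.
move=> cK dd dsep df e0; apply: contrapT => nos.
have /choice [p pP] : forall s : seq X, exists p : X * X, [/\ K p.1, K p.2,
    forall z, z \in s -> d z p.1 = d z p.2 & e <= `|f p.1 - f p.2|].
  move=> s; apply: contrapT => np; apply: nos; exists s => x y Kx Ky sxy.
  by rewrite ltNge; apply/negP => H; apply: np; exists (x, y).
pose G := [set A : set (seq X) | exists s0 : seq X,
  forall s, {subset s0 <= s} -> A s].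
have GF : ProperFilter G.
  apply: Build_ProperFilter_ex => [A [s sA]|]; first by exists s; exact: sA.
  split.
  - by exists [::].
  - move=> A B [s sA] [t tB]; exists (s ++ t) => u stu.
    by split; [apply: sA|apply: tB] => z zs; apply: stu; rewrite mem_cat zs ?orbT.
  - by move=> A B AB [s sA]; exists s => u su; apply: AB; exact: sA.
have [F [FU GsF]] := ultraFilterLemma GF.
have [|x Kx Fx] := weakly_compact_ultra (g := fun s => (p s).1) FU cK.
  by apply: filterS filterT => s _; have [] := pP s.
have [|y Ky Fy] := weakly_compact_ultra (g := fun s => (p s).2) FU cK.
  by apply: filterS filterT => s _; have [] := pP s.
have xy : x = y.
  apply/eqP; rewrite -subr_eq0; apply/eqP/dsep; set z := x - y.
  rewrite dual_funB //; apply/eqP; rewrite subr_eq0; apply/eqP.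
  apply: (cvg_unique (@norm_hausdorff _ _) (Fx _ (dd z))).
  apply: cvg_trans (Fy _ (dd z)); apply: near_eq_cvg; apply: GsF.
  (* Once [s] contains the difference [z], the functional [d z] agrees on both members of the bad
     pair. *)
  exists [:: z] => s zs; have [_ _ dz _] := pP s.
  by rewrite -dz // zs // inE.
have : (f (p s).1 - f (p s).2) @[s --> F] --> f x - f y.
  by apply: cvgB; [exact: Fx|exact: Fy].
rewrite xy subrr => /cvgrPdist_lt/(_ e e0)/filter_ex [s].
rewrite sub0r normrN; have [_ _ _ H] := pP s.
by rewrite ltNge H.
Qed.

Lemma dual_fun_countable_dependence K (d : X -> X -> R) f :
  weakly_compact K -> (forall z, dual_fun (d z)) ->
  (forall z, d z z = 0 -> z = 0) -> dual_fun f ->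
  exists z : nat -> X, forall x y, K x -> K y ->
    (forall i, d (z i) x = d (z i) y) -> f x = f y.
Proof.
move=> cK dd dsep df.
have /choice [s sP] : forall n : nat, exists s : seq X, forall x y, K x -> K y ->
    (forall z, z \in s -> d z x = d z y) -> `|f x - f y| < n.+1%:R^-1.
  by move=> n; apply: (dual_fun_finite_dependence cK dd) => //; rewrite invr_gt0 ltr0n.
(* The finite sets for all accuracies are merged into one sequence through codes of pairs; the
   default 0 only adds harmless entries. *)
exists (fun n => if @unpickle (nat * nat)%type n is Some p then nth 0 (s p.1) p.2 else 0).
move=> x y Kx Ky H; apply/eqP; rewrite -subr_eq0 -normr_eq0 eq_le normr_ge0 andbT.
rewrite leNgt; apply/negP => xy.
have [n] := ltr_add_invr xy; rewrite add0r; apply/negP; rewrite -leNgt ltW //.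
apply: sP => // z zs; have := H (pickle (n, index z (s n))).
by rewrite pickleK /= nth_index.
Qed.

Lemma seq_rat_approx (n : nat) (u : nat -> R) (e : R) : 0 < e ->
  exists2 q : seq rat, size q = n & forall i, (i < n)%N -> `|u i - ratr q`_i| < e.
Proof.
move=> e0; have /choice [q qP] : forall i, exists q : rat, `|u i - ratr q| < e.
  move=> i; have [|q /andP[q1 q2]] := @rat_between R (u i - e) (u i + e); first lra.
  by exists q; rewrite ltr_norml; apply/andP; split; lra.
by exists (mkseq q n) => [|i ni]; rewrite ?size_mkseq // nth_mkseq.
Qed.

(* On [K] a functional factors through the metrizable image of [K] under some
   sequence [z] of the chosen functionals [d]; it is then determined on [K] by
   [z] and its values on a countable subset of [K] that depends only on [z]. *)
Lemma dual_le_continuum : le_continuum X -> @WCG R X ->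
  exists code : (X -> R) -> nat -> bool,
    forall f g, dual_fun f -> dual_fun g -> code f = code g -> f = g.
Proof.
move=> cX [K [cK dK]].
have /choice [d dP] : forall z, exists f, dual_fun f /\ (f z = 0 -> z = 0).
  move=> z; have [f [df _ fz]] := norming_functional z; exists f; split=> //.
  by rewrite fz => /eqP; rewrite normr_eq0 => /eqP.
have dd z : dual_fun (d z) by have [] := dP z.
have dsep z : d z z = 0 -> z = 0 by have [] := dP z.
have /choice [t tP] : forall f, exists z : nat -> X, dual_fun f ->
    forall x y, K x -> K y -> (forall i, d (z i) x = d (z i) y) -> f x = f y.
  move=> f; have [df|nf] := pselect (dual_fun f); last by exists (fun=> 0).
  by have [z zP] := dual_fun_countable_dependence cK dd dsep df; exists z.
(* A pattern [p] prescribes rational values [p.1] for the first functionals along [z], up to an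
   error. Patterns are countably many, and [a] realizes each feasible one by a point depending only
   on [z] and [p]. *)
pose near_pt (z : nat -> X) (p : seq rat * nat) x := K x /\
  forall i, (i < size p.1)%N -> `|d (z i) x - ratr p.1`_i| < p.2.+1%:R^-1.
have /choice [a aP] : forall zp : (nat -> X) * (seq rat * nat), exists x,
    (exists y, near_pt zp.1 zp.2 y) -> near_pt zp.1 zp.2 x.
  move=> zp; have [[y yP]|ny] := pselect (exists y, near_pt zp.1 zp.2 y).
    by exists y.
  by exists 0.
have [c ci] : le_continuum ((nat -> X) * (seq rat * nat -> R)).
  apply: le_continuum_prod; apply: le_continuum_fun => //.
  exact: le_continuum_real.
exists (fun f => c (t f, fun p => f (a (t f, p)))) => f g df dg /ci [tfg].
rewrite -tfg => /funeqP fga; set z := t f in tfg fga.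
have fP := tP f df; have gP := tP g dg; rewrite -/z in fP; rewrite -tfg in gP.
suff fgK x : K x -> f x - g x = 0.
  apply/funext => x; apply/eqP; rewrite -subr_eq0; apply/eqP.
  exact: ((linearly_denseP K).1 dK (fun x => f x - g x) (dual_fun_sub df dg) fgK x).
move=> Kx.
(* The error is twice [n.+1%:R^-1] because [x] and the chosen point are both compared with the same
   rational values. *)
have /choice [y yP] : forall n : nat, exists y, [/\ K y, f y = g y &
    forall i, (i < n)%N -> `|d (z i) x - d (z i) y| < 2 * n.+1%:R^-1].
  move=> n; have n0 : 0 < n.+1%:R^-1 :> R by rewrite invr_gt0 ltr0n.
  have [q qn qx] := seq_rat_approx n (fun i => d (z i) x) n0.
  have [|Ka aq] := aP (z, (q, n)).
    by exists x; split=> //= i; rewrite qn; exact: qx.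
  exists (a (z, (q, n))); split=> // i ni.
  have := aq i; rewrite /= qn => /(_ ni); have := qx i ni.
  rewrite [`|d _ (a _) - _|]distrC => h1 h2.
  have := ler_distD (ratr q`_i) (d (z i) x) (d (z i) (a (z, (q, n)))).
  move: h1 h2; move: n.+1%:R^-1 => b; lra.
have [F [FU ooF]] := ultraFilterLemma (eventually_filter).
have [y0 Ky0 Fy0] : exists2 y0, K y0 & weak_cvg y F y0.
  apply: weakly_compact_ultra cK _.
  by apply: filterS filterT => n _; have [] := yP n.
(* The functionals [d (z i)] do not distinguish [x] from the weak limit [y0], so neither do [f] and
   [g]. *)
have xy0 i : d (z i) x = d (z i) y0.
  apply: (@cvg_unique _ (@norm_hausdorff _ _) (d (z i) (y n) @[n --> F])) => //.
    apply: (@cvg_trans _ (d (z i) (y n) @[n --> \oo])); first exact: cvg_app ooF.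
    apply/cvgrPdist_lt => e e0; have e2 : 0 < e / 2 by rewrite divr_gt0.
    near=> n; have [_ _ H] := yP n; apply: lt_trans (H i _) _; first by near: n; exact: nbhs_infty_gt.
    have : n.+1%:R^-1 < e / 2 :> R.
      near: n; have [m] := ltr_add_invr e2; rewrite add0r => me.
      exists m => // k /= mk; apply: le_lt_trans me.
      by rewrite lef_pV2 ?posrE ?ltr0n // ler_nat ltnS.
    move: n.+1%:R^-1 => b; lra.
  exact: Fy0.
rewrite (fP x y0) // (gP x y0) //; apply/eqP; rewrite subr_eq0; apply/eqP.
apply: (cvg_unique (@norm_hausdorff _ _) (Fy0 f df)).
apply: cvg_trans (Fy0 g dg); apply: near_eq_cvg.
by apply: filterS filterT => n _; have [_ -> _] := yP n.
Unshelve. all: by end_near. Qed.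

End Coding.

(** * Avoiding countably many hyperplanes *)

Lemma scale_below (R : realType) (n : nat) (a b : nat -> R) :
  (forall i, 0 < b i) ->
  exists g : R, 0 < g <= 1 /\ forall i, (i < n)%N -> g * `|a i| <= b i.
Proof.
move=> b0; elim: n => [|n [g [/andP[g0 g1] gP]]]; first by exists 1; rewrite ltr01 lexx.
have a1 : 0 < `|a n| + 1 by rewrite ltr_wpDl.
exists (Num.min g (b n / (`|a n| + 1))); split.
  by rewrite lt_min g0 divr_gt0 //= ge_min g1.
move=> i; rewrite ltnS leq_eqVlt => /orP[/eqP ->|ni].
  apply: (@le_trans _ _ (b n / (`|a n| + 1) * `|a n|)).
    by rewrite ler_wpM2r // ge_min lexx orbT.
  by rewrite mulrAC ler_pdivrMr // ler_wpM2l ?(ltW (b0 n)) // lerDl.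
apply: le_trans (gP i ni); rewrite ler_wpM2r // ge_min lexx //.
Qed.

(** In the application [a i k] is [f i (y k)] and [u k] is the norm of [y k]. The last condition
    lets all terms after [i] together change [f i] by at most a quarter of what term [i] can
    contribute. *)
Lemma small_scales (R : realType) (a : nat -> nat -> R) (u : nat -> R) :
  (forall i, a i i != 0) -> exists d : nat -> R,
    [/\ forall k, 0 < d k <= 1, forall k, d k * `|u k| <= 2^-1 ^+ k &
      forall i k, (i < k)%N -> d k * `|a i k| <= d i * `|a i i| * 2^-1 ^+ k / 4].
Proof.
move=> a0.
(* Index 0 carries the bound on [u k] and index [j.+1] the one on [a j k], so [i < k.+1] covers
   exactly the [j < k]. *)
have /choice [g gP] : forall k, exists g : R, 0 < g <= 1 /\ forall i, (i < k.+1)%N ->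
    g * `|if i is j.+1 then a j k else u k|
      <= (if i is j.+1 then `|a j j| / 4 else 1) * 2^-1 ^+ k.
  move=> k; apply: (@scale_below R k.+1 (fun i => if i is j.+1 then a j k else u k)).
  by move=> [|j]; rewrite mulr_gt0 ?exprn_gt0 ?divr_gt0 ?normr_gt0.
(* All factors are at most 1, so [d k <= d i * g k] for [i < k], and the
   conditions on [g k] do not refer to the earlier scales. *)
pose d k := \prod_(j < k.+1) g j.
have d0 k : 0 < d k by apply: prodr_gt0 => j _; have [/andP[]] := gP j.
have dg k : d k.+1 = d k * g k.+1 by rewrite /d big_ord_recr.
have dE0 : d 0%N = g 0%N by rewrite /d big_ord1.
have dle1 k : d k <= 1.
  elim: k => [|k IH]; first by rewrite dE0; have [/andP[]] := gP 0%N.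
  rewrite dg; have [/andP[g0 g1] _] := gP k.+1.
  by rewrite mulr_ile1 // ltW.
have dleg k : d k <= g k.
  case: k => [|k]; first by rewrite dE0.
  by rewrite dg ler_piMl //; have [/andP[/ltW]] := gP k.+1.
have dlei i k : (i < k)%N -> d k <= d i * g k.
  elim: k => // k IH; rewrite ltnS leq_eqVlt dg => /orP[/eqP ->//|/IH H].
  have [/andP[gk0 _] _] := gP k.+1; have [/andP[_ gk1] _] := gP k.
  rewrite ler_wpM2r ?(ltW gk0) //; apply: le_trans H _.
  by rewrite -[leRHS]mulr1 ler_wpM2l // (ltW (d0 _)).
exists d; split=> [k|k|i k ik].
- by rewrite d0 dle1.
- have [_ /(_ 0%N isT)] := gP k; rewrite mul1r; apply: le_trans.
  by rewrite ler_wpM2r.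
- have [_ /(_ i.+1 ik) H] := gP k.
  apply: (@le_trans _ _ (d i * (g k * `|a i k|))).
    by rewrite mulrA ler_wpM2r // dlei.
  apply: le_trans (ler_wpM2l (ltW (d0 i)) H) _.
  by move: (d i) (2^-1 ^+ k) => x y; lra.
Qed.

(** A greedy sum: with [y n] in [K] off the kernel of [f n], the term [d n *: y n] is added only if
    [f n] is too small at the current partial sum. *)
Lemma avoid_hyperplanes (R : realType) (X : completeNormedModType R) (K : set X)
    (f : nat -> X -> R) :
  linearly_dense K -> (forall n, dual_fun (f n)) ->
  (forall n, exists x, f n x != 0) ->
  exists x, (forall n, f n x != 0) /\ exists w : nat -> X,
    (forall n, `|w n| <= 2^-1 ^+ n /\
      exists2 c, 0 <= c <= 1 & exists2 y, K y & w n = c *: y) /\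
    series w @ \oo --> x.
Proof.
move=> dK df f0.
have /choice [y yP] : forall n, exists y, K y /\ f n y != 0.
  move=> n; apply: contrapT => ny; have [x /eqP] := f0 n; apply.
  apply: ((linearly_denseP K).1 dK (f n) (df n)) => z Kz.
  by apply/eqP; apply: contraT => fz; case: ny; exists z.
have [|d [d01 dy dP]] := @small_scales R (fun i k => f i (y k)) (fun k => `|y k|).
  by move=> i; have [] := yP i.
(* Step [i] makes [|f i|] at least [m i / 2]; all later steps together lower it
   by at most [m i / 4]. *)
pose m i := d i * `|f i (y i)|.
have m0 i : 0 < m i.
  by rewrite mulr_gt0 ?normr_gt0; [|have /andP[] := d01 i|have [] := yP i].
pose s := fix s n : X := if n is k.+1 then
  (if m k / 2 <= `|f k (s k)| then s k else s k + d k *: y k) else 0.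
pose w n := s n.+1 - s n.
have ws : series w = s.
  apply/funext => n; rewrite /series /= telescope_sumr //.
  by rewrite subr0.
have wE n : w n = 0 \/ w n = d n *: y n.
  rewrite /w /=; case: ifP => _; first by left; rewrite subrr.
  by right; rewrite addrAC subrr add0r.
have wP n : `|w n| <= 2^-1 ^+ n /\
    exists2 c, 0 <= c <= 1 & exists2 y, K y & w n = c *: y.
  have [Ky _] := yP n; have /andP[dn0 dn1] := d01 n.
  case: (wE n) => ->; split.
  - by rewrite normr0 exprn_ge0.
  - by exists 0; rewrite ?lexx ?ler01 //; exists (y n); rewrite ?scale0r.
  - by rewrite normrZ gtr0_norm //; have := dy n; rewrite normr_id.
  - by exists (d n); rewrite ?(ltW dn0) //; exists (y n).
have wx := geometric_bound_cvg (fun n => (wP n).1); set x := limn (series w) in wx.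
exists x; split; last by exists w.
move=> i; have mge0 k : 0 <= m i * 2^-1 ^+ k.
  by apply: mulr_ge0; [exact: ltW|rewrite exprn_ge0].
(* This bound drops at each step by exactly the most that the next term can take away, and it stays
   above [m i / 4]. *)
have sm N : m i / 4 + m i / 2 * 2^-1 ^+ (i.+1 + N) <= `|f i (s (i.+1 + N)%N)|.
  elim: N => [|N IH].
    rewrite addn0; apply: (@le_trans _ _ (m i / 2)).
      have : 2^-1 ^+ i.+1 <= 2^-1 :> R.
        by rewrite exprS -[leRHS]mulr1 ler_wpM2l // exprn_ile1 //; lra.
      have := m0 i; move: (m i) (2^-1 ^+ i.+1) => a b a0 b1.
      have : a / 2 * b <= a / 2 * 2^-1 by rewrite ler_wpM2l //; lra.
      lra.
    (* If the term was added, it contributes [m i] against less than [m i / 2] already present. *)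
    rewrite /=; case: ifP => [//|/negbT]; rewrite -ltNge => lt.
    rewrite (dual_funD _ _ (df i)) (dual_funZ _ _ (df i)).
    have := lerB_normD (d i * f i (y i)) (f i (s i)).
    have /andP[di0 _] := d01 i; rewrite normrM (gtr0_norm di0) [f i (s i) + _]addrC -/(m i).
    lra.
  rewrite addnS -[s _.+1](subrK (s (i.+1 + N)%N)) -/(w _) (dual_funD _ _ (df i)).
  have fw : `|f i (w (i.+1 + N)%N)| <= m i * 2^-1 ^+ (i.+1 + N) / 4.
    case: (wE (i.+1 + N)%N) => ->.
      by rewrite (dual_fun0 (df i)) normr0 divr_ge0.
    have /andP[di0 _] := d01 (i.+1 + N)%N.
    rewrite (dual_funZ _ _ (df i)) normrM (gtr0_norm di0); apply: dP.
    by rewrite addSn ltnS leq_addr.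
  have := lerB_normD (f i (s (i.+1 + N)%N)) (f i (w (i.+1 + N)%N)).
  rewrite [_ + f i (s _)]addrC exprS.
  move: IH fw; move: (2^-1 ^+ (i.+1 + N)) => b.
  lra.
apply/eqP => fx0.
have : f i (s n) @[n --> \oo] --> f i x.
  by apply: continuous_cvg; [exact: (df i).2|rewrite -ws].
have m4 : 0 < m i / 4 by rewrite divr_gt0.
move=> /cvgrPdist_lt/(_ _ m4) [N _ NP].
have := NP (i.+1 + N)%N; rewrite /= leq_addl fx0 sub0r normrN => /(_ isT).
have := sm N; have := mge0 (i.+1 + N)%N; lra.
Qed.

(** * Overcomplete sets *)

(** Otherwise [x] alone would be linearly dense, and its rational multiples would form a countable
    dense set. *)
Lemma singleton_annihilator (R : realType) (X : normedModType R) (x : X) :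
  @dens_aleph1 R X -> exists f : X -> R,
    [/\ dual_fun f, f x = 0 & exists y, f y != 0].
Proof.
move=> [_ nsep]; apply: contrapT => nf.
have dx : linearly_dense [set x].
  apply/linearly_denseP => f df fx y; apply/eqP; apply: contraT => fy.
  by case: nf; exists f; split=> //; [exact: fx|exists y].
apply: (nsep (range (fun q : rat => ratr q *: x))); last first.
  by apply: sub_countable (countableP [set: rat]); exact: card_image_le.
rewrite /dense_set -subTset => y _ B /nbhs_ballP[e /= e0 eB].
have e2 : 0 < e / 2 by rewrite divr_gt0.
have : closure (lin_span [set x]) y by rewrite dx.
move=> /(_ (ball y (e / 2)) (nbhsx_ballx _ _ e2)) [z [[n [c [v [vx ->]]]]]].
rewrite -ball_normE /= => yz.
have {}yz : `|y - (\sum_(i < n) c i) *: x| < e / 2.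
  rewrite scaler_suml; congr (`|_ - _| < _): yz.
  by apply: eq_bigr => i _; rewrite (vx i).
set a := \sum_(i < n) c i in yz.
have x1 : 0 < `|x| + 1 by rewrite ltr_wpDl.
have [|q /andP[aq qa]] := @rat_between R a (a + e / 2 / (`|x| + 1)).
  by rewrite ltrDl divr_gt0.
exists (ratr q *: x); split; first by exists q.
apply: eB; rewrite -ball_normE /=.
have := ler_distD (a *: x) y (ratr q *: x).
have : `|a *: x - ratr q *: x| <= e / 2.
  rewrite -scalerBl normrZ distrC gtr0_norm ?subr_gt0 //.
  apply: (@le_trans _ _ (e / 2 / (`|x| + 1) * `|x|)).
    by rewrite ler_wpM2r //; lra.
  by rewrite mulrAC ler_pdivrMr // ler_wpM2l ?(ltW e2) // lerDl.
lra.
Qed.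

Lemma countable_closed_segment (T : Type) (r : T -> T -> Prop) (x : T) :
  countable [set y | r y x] -> countable [set y | r y x \/ y = x].
Proof.
move=> /countable_injP[e ei].
apply/countable_injP; exists (fun y => if `[< r y x >] then (e y).+1 else 0%N).
move=> y z /set_mem /= Hy /set_mem /= Hz.
case: asboolP => [ryx|nyx]; case: asboolP => [rzx|nzx] //.
  by case=> eyz; apply: ei => //; exact: mem_set.
by case: Hy Hz => // -> [].
Qed.

(** The well-order of [U] is pulled back along [h]. *)
Lemma is_aleph1_inj (T U : Type) (A : set T) (h : T -> U) :
  is_aleph1 [set: U] -> ~ countable A ->
  (forall x y, A x -> A y -> h x = h y -> x = y) -> is_aleph1 A.
Proof.
move=> [_ [r [[rirr rtr rtot rmin] seg]]] uA hi; split=> //.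
exists (fun x y => r (h x) (h y)); split; first split.
- by move=> x Ax; exact: rirr.
- by move=> x y z _ _ _; exact: rtr.
- move=> x y Ax Ay; have [] := rtot (h x) (h y) I I.
  + by constructor 1.
  + by constructor 2; exact: hi.
  + by constructor 3.
- move=> B BA [b Bb]; have [||_ [m Bm <-] mmin] := rmin (h @` B).
  + by move=> y _.
  + by exists (h b), b.
  + by exists m => // c Bc; apply: mmin; exists c.
move=> x Ax; have /countable_injP[e ei] := seg (h x) I.
apply/countable_injP; exists (e \o h) => y z /set_mem[Ay yx] /set_mem[Az zx] /= eyz.
by apply: hi => //; apply: ei => //; apply: mem_set.
Qed.

Theorem theorem4p5 (R : realType) (X : completeNormedModType R) :
  CH -> @WCG R X -> @dens_aleph1 R X ->
  exists S : set X, relatively_weakly_compact S /\ overcomplete S.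
Proof.
(* Binary sequences, well-ordered by [r], serve both as indices of points and as codes of
   functionals. *)
move=> ch wcg dens; have [unc [r [[rirr rtr rtot rmin] seg]]] := ch.
have {}seg a : countable [set b | r b a].
  by apply: sub_countable (seg a I); apply: subset_card_le.
have [code codeI] := dual_le_continuum (cardinal_dense unc dens) wcg.
have [K [cK dK]] := wcg.
(* [f0] fills the places of the sequence [F] below that no functional occupies. *)
have [f0 [df0 _ nz0]] := singleton_annihilator 0 dens.
pose L : set X := [set x : X | exists w : nat -> X, (forall n, `|w n| <= 2^-1 ^+ n /\
    exists2 c : R, 0 <= c <= 1 & exists2 y, K y & w n = c *: y) /\
  series w @ \oo --> x].
have cL : weakly_compact L.
  apply: (weakly_compact_series (P := fun n => [set v | `|v| <= 2^-1 ^+ n /\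
    exists2 c, 0 <= c <= 1 & exists2 y, K y & v = c *: y])) => n.
    exact: weakly_compact_scaled_ball.
  by move=> w [].
have /choice [p pP] : forall a, exists x, L x /\ forall f : X -> R, dual_fun f ->
    (exists y, f y != 0) -> r (code f) a \/ code f = a -> f x != 0.
  move=> a; have /countable_injP[e ei] := countable_closed_segment (seg a).
  have /choice [F FP] : forall n, exists f : X -> R,
      [/\ dual_fun f, exists y, f y != 0 & forall g, dual_fun g ->
        (exists y, g y != 0) -> r (code g) a \/ code g = a ->
        e (code g) = n -> g = f].
    move=> n; have [[f [df nzf fa fn]]|nf] := pselect (exists f : X -> R,
        [/\ dual_fun f, exists y, f y != 0, r (code f) a \/ code f = a
          & e (code f) = n]).
      exists f; split=> // g dg nzg ga gn; apply: codeI => //.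
      by apply: ei; [exact: mem_set|exact: mem_set|rewrite gn].
    by exists f0; split=> // g dg nzg ga gn; case: nf; exists g.
  have [||x [Fx Lx]] := avoid_hyperplanes (f := F) dK.
  - by move=> n; have [] := FP n.
  - by move=> n; have [] := FP n.
  exists x; split=> // f df nzf fa; have [_ _ H] := FP (e (code f)).
  by rewrite (H f).
(* Hence a nonzero functional vanishes at [p a] for only countably many [a]. *)
have below f a : dual_fun f -> (exists y, f y != 0) -> f (p a) = 0 -> r a (code f).
  move=> df nzf fa; have [_ /(_ f df nzf) H] := pP a.
  have [||] // := rtot a (code f) I I.
    by move=> E; move: H; rewrite fa eqxx E => H; have : false by apply: H; right.
  by move=> ra; move: H; rewrite fa eqxx => H; have : false by apply: H; left.
pose S := range p.
(* Each point is annihilated by some nonzero functional. If [S] were countable, countably many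
   countable initial segments would cover all indices. *)
have uS : ~ countable S.
  move=> cS; apply: unc.
  have /choice [k kP] : forall x : X, exists f : X -> R,
      [/\ dual_fun f, f x = 0 & exists y, f y != 0].
    by move=> x; exact: singleton_annihilator dens.
  apply: sub_countable (bigcup_countable cS (fun x _ => seg (code (k x)))).
  apply: subset_card_le => a _; exists (p a); first by exists a.
  by have [df fpa nzf] := kP (p a); exact: below.
exists S; split.
  by apply: relatively_weakly_compact_sub cL _ => _ [a _ <-]; have [] := pP a.
split.
  have /choice [h hP] : forall x, exists a, S x -> p a = x.
    move=> x; have [[a _ pa]|nS] := pselect (S x); first by exists a.
    by exists (fun=> false).
  apply: (is_aleph1_inj (h := h)) => // x y Sx Sy hxy.
  by rewrite -(hP x Sx) hxy hP.
move=> M MS MeqS; apply/linearly_denseP => f df fM x; apply/eqP.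
apply: contraT => fx; case: uS.
(* All points of [M] come from indices before [code f], whereas [M] is equinumerous with the
   uncountable [S]. *)
have : countable M.
  have : countable (p @` [set a | r a (code f)]).
    by apply: sub_countable (seg (code f)); exact: card_image_le.
  apply: sub_countable; apply: subset_card_le => y My.
  have [a _ pa] := MS y My; exists a => //.
  by apply: below => //; [exists x|rewrite pa; exact: fM].
by rewrite (eq_countable MeqS).
Qed.
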